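(* Let $P^{\mathrm{obs}}$ be a Borel probability law of $(Y,X)$ with $Y\in\mathbb R^T$, $X=(X_1,\dots,X_T)$, $X_t\in\mathbb R^k$, let $\tau\in(0,1)$, $c_\tau=\max\{\tau,1-\tau\}$, and $R_t(b)=Y_t-X_t'b$. If $b\in\Theta_I^{\mathrm{str}}$, then for every $v\in\mathbb R$, every ordered pair $s\ne t$ in $\{1,\dots,T\}$, and $P_X$-almost every $x$, $$P^{\mathrm{obs}}\{R_s(b)\le v<R_t(b)\mid X=x\}\le c_\tau .$$ In particular, for $\tau=1/2$ the bound is $1/2$ in either direction of crossing.
   Context: $T,k\ge1$ are fixed integers and $\mathcal B\subseteq\mathbb R^k$. $\Theta_I^{\mathrm{str}}$ is the set of $b\in\mathcal B$ for which there exists a Borel probability law $P^{\mathrm s}$ of $(Y,X,A,U)$, $A\in\mathbb R$, $U\in\mathbb R^T$, with $(Y,X)$-marginal $P^{\mathrm{obs}}$, with $Y_t=X_t'b+A+U_t$ a.s. for all $t$, and with $P^{\mathrm s}(U_t\le0\mid X,A)\ge\tau$, $P^{\mathrm s}(U_t<0\mid X,A)\le\tau$ a.s. for all $t$. $P_X$ is the marginal law of $X$. *)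

(* Defs.v *)
From HB Require Import structures.
From mathcomp Require Import all_boot all_order all_algebra.
From mathcomp Require Import all_classical all_reals all_analysis.
From mathcomp Require Import measurable_realfun.

Set Implicit Arguments.
Unset Strict Implicit.
Unset Printing Implicit Defensive.

Import Order.TTheory GRing.Theory Num.Theory.
Import numFieldNormedType.Exports.

Local Open Scope classical_set_scope.
Local Open Scope ring_scope.

Section conditional_probability.
Context d d' (W : measurableType d) (S : measurableType d') (R : realType).
Variables (P : probability W R) (Z : {RV P >-> S}).
Local Open Scope ereal_scope.

(* [g] is a version of the function z |-> P (E | Z = z). *)
Definition is_cond_prob (E : set W) (g : S -> \bar R) : Prop :=
  (distribution P Z).-integrable [set: S] g /\
  forall B, measurable B ->
    P (E `&` Z @^-1` B) = \int[distribution P Z]_(z in B) g z.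

(* A chosen version; it exists for every measurable [E] ([cond_probP]) and is
   unique up to a [distribution P Z]-null set ([is_cond_prob_unique]). *)
Definition cond_prob (E : set W) : S -> \bar R :=
  xget (cst 0) [set g | is_cond_prob E g].

Lemma is_cond_prob_unique (E : set W) (g h : S -> \bar R) :
  is_cond_prob E g -> is_cond_prob E h -> ae_eq (distribution P Z) setT g h.
Proof.
move=> [ig gE] [ih hE]; apply: integral_ae_eq => //.
  exact: measurable_int ih.
by move=> B _ mB; rewrite -gE// hE.
Qed.

Lemma is_cond_prob_exists (E : set W) : measurable E ->
  exists g, is_cond_prob E g.
Proof.
move=> mE.
have mZ B : measurable B -> measurable (Z @^-1` B).
  by move=> mB; rewrite -[X in measurable X]setTI; exact: measurable_funP.
pose nu B := P (E `&` Z @^-1` B).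
have nu0 : nu set0 = 0 by rewrite /nu preimage_set0 setI0 measure0.
have nufin B : measurable B -> nu B \is a fin_num.
  move=> mB; rewrite fin_num_measure//; apply: measurableI => //; exact: mZ.
have nusa : semi_sigma_additive nu.
  move=> F mF tF mUF; rewrite /nu preimage_bigcup setI_bigcupr.
  apply: measure_semi_sigma_additive.
  - by move=> n; apply: measurableI => //; exact: mZ.
  - apply/trivIsetP => /= i j _ _ ij; rewrite setIACA -preimage_setI.
    by move/trivIsetP : tF => /(_ _ _ _ _ ij) ->//; rewrite preimage_set0 setI0.
  - rewrite -setI_bigcupr -preimage_bigcup; apply: measurableI => //; exact: mZ.
pose nu_mixin := isCharge.Build _ _ _ nu nu0 nufin nusa.
pose nuC : {charge set S -> \bar R} := HB.pack nu nu_mixin.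
have dom : nuC `<< distribution P Z.
  apply/null_content_dominatesP => A mA PA0.
  apply/eqP; rewrite eq_le; apply/andP; split; last exact: measure_ge0.
  rewrite -PA0; apply: le_measure; rewrite ?inE//.
  - by apply: measurableI => //; exact: mZ.
  - exact: mZ.
exists (Radon_Nikodym nuC (distribution P Z)); split.
  exact: Radon_Nikodym_integrable.
by move=> B mB; rewrite -Radon_Nikodym_integral.
Qed.

Lemma cond_probP (E : set W) : measurable E -> is_cond_prob E (cond_prob E).
Proof. by move=> /is_cond_prob_exists[g Eg]; exact: (@xgetI _ (cst 0) [set h | is_cond_prob E h] g Eg). Qed.

End conditional_probability.
Arguments is_cond_prob {d d' W S R} P Z E g.
Arguments cond_prob {d d' W S R} P Z E.

(* R^n with its Borel sigma-algebra, which is the product sigma-algebra that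
   tuples carry. *)
Notation Rvec R n := (n.-tuple (measurableTypeR R)).

(* Values of (Y, X), and of (Y, X, A, U) nested as ((Y, X), A), U. *)
Notation obs_space R T k := (Rvec R T * T.-tuple (Rvec R k))%type.
Notation str_space R T k := (obs_space R T k * measurableTypeR R * Rvec R T)%type.

Section panel.
Context {R : realType} {T k : nat}.

Definition dotv (x b : Rvec R k) : R := \sum_(j < k) tnth x j * tnth b j.

Definition obsX (w : obs_space R T k) : T.-tuple (Rvec R k) := w.2.

Definition residual (b : Rvec R k) (t : 'I_T) (w : obs_space R T k) : R :=
  tnth w.1 t - dotv (tnth (obsX w) t) b.

Definition strYX (w : str_space R T k) : obs_space R T k := w.1.1.

Definition strA (w : str_space R T k) : R := w.1.2.

Definition strU (w : str_space R T k) : Rvec R T := w.2.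

Definition strXA (w : str_space R T k) :
  (T.-tuple (Rvec R k) * measurableTypeR R)%type := (obsX (strYX w), strA w).

Lemma measurable_obsX : measurable_fun [set: obs_space R T k] obsX.
Proof. exact: measurable_snd. Qed.

HB.instance Definition _ := isMeasurableFun.Build _ _ _ _ obsX measurable_obsX.

Lemma measurable_strXA : measurable_fun [set: str_space R T k] strXA.
Proof.
apply/measurable_fun_pairP; split; rewrite /comp /=.
- apply: measurableT_comp; first exact: measurable_obsX.
  by apply: measurableT_comp => //; exact: measurable_fst.
- by apply: (measurableT_comp measurable_snd); exact: measurable_fst.
Qed.

HB.instance Definition _ := isMeasurableFun.Build _ _ _ _ strXA measurable_strXA.

Lemma measurable_residual (b : Rvec R k) (t : 'I_T) :
  measurable_fun [set: obs_space R T k] (residual b t).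
Proof.
apply: measurable_funB.
  apply: (measurableT_comp (@measurable_tnth _ (measurableTypeR R) T t)).
  exact: measurable_fst.
apply: measurable_sum => j; apply: measurable_funM => //.
apply: (measurableT_comp (@measurable_tnth _ (measurableTypeR R) k j)).
apply: (measurableT_comp (@measurable_tnth _ (Rvec R k) T t)).
exact: measurable_obsX.
Qed.

Lemma measurable_crossing (b : Rvec R k) (s t : 'I_T) (v : R) :
  measurable [set w : obs_space R T k | residual b s w <= v < residual b t w].
Proof.
rewrite [X in measurable X](_ : _ =
    (residual b s @^-1` `]-oo, v]) `&` (residual b t @^-1` `]v, +oo[)); last first.
  by apply/seteqP; split => w /=; rewrite !in_itv/= andbT => /andP.
by apply: measurableI; rewrite -[X in measurable X]setTI;
  apply: measurable_residual.
Qed.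

Lemma measurable_strU (t : 'I_T) (I : interval R) :
  measurable [set w : str_space R T k | tnth (strU w) t \in I].
Proof.
have mU : measurable_fun [set: str_space R T k] (fun w => tnth (strU w) t).
  apply: (measurableT_comp (@measurable_tnth _ (measurableTypeR R) T t)).
  exact: measurable_snd.
rewrite [X in measurable X](_ : _ =
  [set: str_space R T k] `&` (fun w => tnth (strU w) t) @^-1` [set` I]).
  by apply: mU.
by rewrite setTI.
Qed.

Definition identified_set (B : set (Rvec R k)) (tau : R)
    (Pobs : probability (obs_space R T k) R) : set (Rvec R k) :=
  [set b | B b /\
    exists Ps : probability (str_space R T k) R,
    [/\ forall E, measurable E -> Ps (strYX @^-1` E) = Pobs E,
        {ae Ps, forall w, forall t : 'I_T,
          tnth (strYX w).1 t =
            dotv (tnth (strYX w).2 t) b + strA w + tnth (strU w) t}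
      & forall t : 'I_T,
        {ae Ps, forall w,
          (tau%:E <= cond_prob Ps strXA [set w' | (tnth (strU w') t <= 0)%R]
                       (strXA w))%E} /\
        {ae Ps, forall w,
          (cond_prob Ps strXA [set w' | (tnth (strU w') t < 0)%R]
             (strXA w) <= tau%:E)%E} ]].

End panel.

(* Main.v *)
(* On the crossing event, R_s = A + U_s <= v < A + U_t = R_t.  If A <= v this
   forces U_t > 0, and if A > v it forces U_s < 0.  Given (X, A) the first has
   probability at most 1 - tau and the second at most tau, and which case occurs
   is determined by A; so given X the crossing has probability at most the
   larger of the two. *)
Require Import Defs.
From mathcomp Require Import all_boot all_order all_algebra.
From mathcomp Require Import all_classical all_reals all_analysis.
From mathcomp Require Import measurable_realfun lra.
Import Order.TTheory GRing.Theory Num.Theory.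

Local Open Scope classical_set_scope.
Local Open Scope ring_scope.

Section ae_comparison.
Context {d} {S : measurableType d} {R : realType}.
Variable mu : {measure set S -> \bar R}.
Local Open Scope ereal_scope.

(** The exceptions lie in a null set [N], so [A] is included in the union of [B] and [N], which
    weighs no more than [B]. *)
Lemma le_measure_ae (A B : set S) : measurable A -> measurable B ->
  {ae mu, forall x, A x -> B x} -> mu A <= mu B.
Proof.
move=> mA mB [N [mN N0 ABN]].
have -> : mu B = mu B + mu N by rewrite N0 adde0.
apply: le_trans (measureU2 _ mB mN); apply: le_measure; rewrite ?inE//.
  exact: measurableU.
move=> x Ax; case: (pselect (B x)) => [|nBx]; first by left.
by right; apply: ABN => /= /(_ Ax).
Qed.

(** Cutting the exceptional null set out of [D] changes neither integral and makes the inequality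
    hold pointwise. *)
Lemma ae_le_integral (D : set S) (f g : S -> \bar R) : measurable D ->
  mu.-integrable D f -> mu.-integrable D g ->
  {ae mu, forall x, D x -> f x <= g x} ->
  \int[mu]_(x in D) f x <= \int[mu]_(x in D) g x.
Proof.
move=> mD intf intg [N [mN N0 fgN]].
rewrite (negligible_integral _ _ _ N0)// [leRHS](negligible_integral _ _ _ N0)//.
have mDN : measurable (D `\` N) by exact: measurableD.
apply: le_integral => //; [exact: integrableS intf|exact: integrableS intg|].
move=> x; rewrite inE => -[Dx Nx].
by apply: contrapT => nfg; apply: Nx; apply: fgN => /= /(_ Dx).
Qed.

(** Localization: the set where [g < f] is measurable, so it can be tested against the integral
    inequality and turns out to be null. *)
Lemma integral_ae_le (f g : S -> \bar R) :
  mu.-integrable setT f -> mu.-integrable setT g ->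
  (forall B, measurable B ->
    \int[mu]_(x in B) f x <= \int[mu]_(x in B) g x) ->
  {ae mu, forall x, f x <= g x}.
Proof.
move=> intf intg fg.
have mf := measurable_int _ intf; have mg := measurable_int _ intg.
pose A := [set x | g x < f x].
have mA : measurable A.
  by rewrite -[A]setTI; exact: emeasurable_fun_lt.
have : ae_eq mu A f g.
  apply: integral_ae_eq => //.
  - exact: integrableS intf.
  - exact: measurable_funS mg.
  (* The assumption gives one inequality between the integrals over [E]; the other holds because
     [g < f] on all of [A]. *)
  move=> E EA mE; apply/eqP; rewrite eq_le fg//=; apply: le_integral => //.
  - exact: integrableS intg.
  - exact: integrableS intf.
  - by move=> x; rewrite inE => /EA/ltW.
apply: filterS => x fgx; rewrite leNgt; apply/negP => Ax.
by move: (Ax); rewrite fgx// ltxx.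
Qed.

End ae_comparison.

Section cond_prob_bounds.
Context {d d'} {W : measurableType d} {S : measurableType d'} {R : realType}.
Variables (P : probability W R) (Z : {RV P >-> S}).
Local Open Scope ereal_scope.

(** The quantile restrictions hold along [Z w] for [P]-almost every [w], while conditional
    probabilities are integrated against the law of [Z]; this passes from the former to the
    latter. *)
Lemma ae_distribution (Q : set S) : measurable Q ->
  {ae P, forall w, Q (Z w)} -> {ae distribution P Z, forall z, Q z}.
Proof.
move=> mQ aeQ.
have mZQ : measurable (Z @^-1` ~` Q).
  rewrite -[X in measurable X]setTI.
  by apply: measurable_funP => //; exact: measurableC.
exists (~` Q); split => //; first exact: measurableC.
exact: (measure_negligible mZQ aeQ).
Qed.

Lemma integrable_cst_distribution (c : R) :
  (distribution P Z).-integrable [set: S] (cst c%:E).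
Proof. exact: finite_measure_integrable_cst. Qed.

Lemma integral_cst_distribution (c : R) (B : set S) : measurable B ->
  \int[distribution P Z]_(z in B) cst c%:E z = c%:E * P (Z @^-1` B).
Proof. by move=> mB; rewrite integral_cst. Qed.

Variables (E : set W) (c : R).
Hypothesis mE : measurable E.

(** Both sides of the assumption are integrals over [B] against the law of [Z], so [integral_ae_le]
    applies. A bound given [Z] thus reduces to unconditional inequalities. *)
Lemma cond_prob_le :
  (forall B, measurable B -> P (E `&` Z @^-1` B) <= c%:E * P (Z @^-1` B)) ->
  {ae distribution P Z, forall z, cond_prob P Z E z <= c%:E}.
Proof.
move=> EB; have [intE intEB] := cond_probP Z mE.
apply: (@integral_ae_le _ _ _ _ _ (cst c%:E)) => //.
  exact: integrable_cst_distribution.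
by move=> B mB; rewrite -intEB// integral_cst_distribution//; exact: EB.
Qed.

Lemma measure_cond_prob_le (B : set S) : measurable B ->
  {ae P, forall w, cond_prob P Z E (Z w) <= c%:E} ->
  P (E `&` Z @^-1` B) <= c%:E * P (Z @^-1` B).
Proof.
move=> mB aeE; have [intE intEB] := cond_probP Z mE.
rewrite intEB// -integral_cst_distribution//; apply: ae_le_integral => //.
- exact: integrableS intE.
- by apply: integrableS (integrable_cst_distribution c).
have : {ae distribution P Z, forall z, cond_prob P Z E z <= c%:E}.
  apply: (@ae_distribution [set z | cond_prob P Z E z <= c%:E]) => //.
  rewrite -[X in measurable X]setTI; apply: emeasurable_fun_infty_c => //.
  exact: measurable_int intE.
by apply: filterS => z + _.
Qed.

Lemma measure_cond_prob_ge (B : set S) : measurable B ->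
  {ae P, forall w, c%:E <= cond_prob P Z E (Z w)} ->
  c%:E * P (Z @^-1` B) <= P (E `&` Z @^-1` B).
Proof.
move=> mB aeE; have [intE intEB] := cond_probP Z mE.
rewrite intEB// -integral_cst_distribution//; apply: ae_le_integral => //.
- by apply: integrableS (integrable_cst_distribution c).
- exact: integrableS intE.
have : {ae distribution P Z, forall z, c%:E <= cond_prob P Z E z}.
  apply: (@ae_distribution [set z | c%:E <= cond_prob P Z E z]) => //.
  rewrite -[X in measurable X]setTI; apply: emeasurable_fun_c_infty => //.
  exact: measurable_int intE.
by apply: filterS => z + _.
Qed.

Lemma measure_setC_cond_prob_ge (B : set S) : measurable B ->
  {ae P, forall w, c%:E <= cond_prob P Z E (Z w)} ->
  P (~` E `&` Z @^-1` B) <= (1 - c)%:E * P (Z @^-1` B).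
Proof.
move=> mB /measure_cond_prob_ge-/(_ _ mB).
have mZB : measurable (Z @^-1` B).
  by rewrite -[X in measurable X]setTI; exact: measurable_funP.
have -> : P (Z @^-1` B) = P (~` E `&` Z @^-1` B) + P (E `&` Z @^-1` B).
  by rewrite [_ `&` Z @^-1` B]setIC [E `&` _]setIC -setDE; exact: measureDI.
(* Finiteness reduces the subtraction to real arithmetic. *)
have finP A : measurable A -> P A \is a fin_num by exact: fin_num_measure.
have := finP _ (measurableI _ _ (measurableC mE) mZB).
have := finP _ (measurableI _ _ mE mZB).
move: (P (E `&` _)) (P (~` E `&` _)) => [x| |] [y| |]//= _ _.
by rewrite -EFinD -!EFinM !lee_fin; lra.
Qed.

End cond_prob_bounds.

Section panel.
Context {R : realType} {T k : nat}.
Local Open Scope ereal_scope.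

(** This is the bound integrated over the event that [X] lies in [C]. In this form no iterated
    conditioning is needed: bounds given [(X, A)] are integrated over events determined by
    [(X, A)]. *)
Lemma crossing_measure_le (B : set (Rvec R k)) (tau : R)
    (Pobs : probability (obs_space R T k) R) (b : Rvec R k) (v : R)
    (s t : 'I_T) (C : set (T.-tuple (Rvec R k))) :
  identified_set B tau Pobs b -> measurable C ->
  Pobs ([set w | (residual b s w <= v < residual b t w)%R] `&` obsX @^-1` C)
    <= (Num.max tau (1 - tau))%:E * Pobs (obsX @^-1` C).
Proof.
move=> [_ [Ps [PsYX model quantile]]] mC; set c := Num.max _ _.
have mXC : measurable ((obsX : obs_space R T k -> _) @^-1` C).
  by rewrite -[X in measurable X]setTI; exact: measurable_obsX.
(* [low] and [high] cut the event at [A = v]; as sets of values of [(X, A)], they are admissible for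
   the quantile restrictions. *)
pose low : set (T.-tuple (Rvec R k) * measurableTypeR R) :=
  C `*` [set` `]-oo, v]%R].
pose high : set (T.-tuple (Rvec R k) * measurableTypeR R) :=
  C `*` [set` `]v, +oo[%R].
have mlow : measurable low by apply: measurableX => //; exact: measurable_itv.
have mhigh : measurable high by apply: measurableX => //; exact: measurable_itv.
have mXA D : measurable D -> measurable ((strXA : str_space R T k -> _) @^-1` D).
  by move=> mD; rewrite -[X in measurable X]setTI; exact: measurable_strXA.
have mUle : measurable [set w : str_space R T k | (tnth (strU w) t <= 0)%R].
  rewrite [X in measurable X](_ : _ = [set w | tnth (strU w) t \in `]-oo, 0%R]]).
    exact: measurable_strU.
  by apply/seteqP; split=> w /=; rewrite in_itv.
have mUlt : measurable [set w : str_space R T k | (tnth (strU w) s < 0)%R].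
  rewrite [X in measurable X](_ : _ = [set w | tnth (strU w) s \in `]-oo, 0%R[]).
    exact: measurable_strU.
  by apply/seteqP; split=> w /=; rewrite in_itv.
pose up :=
  ~` [set w : str_space R T k | (tnth (strU w) t <= 0)%R] `&` strXA @^-1` low.
pose down :=
  [set w : str_space R T k | (tnth (strU w) s < 0)%R] `&` strXA @^-1` high.
have mup : measurable up.
  by apply: measurableI; [exact: measurableC|exact: mXA].
have mdown : measurable down by apply: measurableI => //; exact: mXA.
have mcross : measurable
    ([set w | (residual b s w <= v < residual b t w)%R] `&` obsX @^-1` C).
  by apply: measurableI => //; exact: measurable_crossing.
have mYX D : measurable D -> measurable ((strYX : str_space R T k -> _) @^-1` D).
  move=> mD; rewrite -[X in measurable X]setTI.
  suff: measurable_fun setT (strYX : str_space R T k -> _) by apply.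
  by apply: (measurableT_comp measurable_fst); exact: measurable_fst.
rewrite -!PsYX//.
(* The inclusion holds only almost surely, since the model equation does. *)
apply: (@le_trans _ _ (Ps (up `|` down))).
  apply: le_measure_ae; [exact: mYX|exact: measurableU|].
  apply: filterS model => w Ymodel [/= /andP[]].
  rewrite /residual !Ymodel => Rs Rt XC.
  have [Av|vA] := leP (strA w) v.
    by left; split; [apply/negP; rewrite -ltNge; move: Rt Av; rewrite /obsX; lra
                    |split => //=; rewrite in_itv].
  right; split; first by move: Rs vA; rewrite /= /obsX; lra.
  by split => //=; rewrite in_itv/= vA.
apply: (le_trans (measureU2 _ mup mdown)).
(* The two cells partition the event that [X] lies in [C], so a constant common to both cells
   factors out of the sum. *)
have -> : strYX @^-1` (obsX @^-1` C) =
    (strXA @^-1` low) `|` (strXA @^-1` high) :> set (str_space R T k).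
  apply/seteqP; split => [w Cw|w [[]|[]]//].
  by have [Av|vA] := leP (strA w) v; [left|right]; split => //=;
    rewrite in_itv//= vA.
rewrite measureU; [|exact: mXA|exact: mXA|]; last first.
  apply/seteqP; split => // w [[_ /=]]; rewrite in_itv/= => Av [_ /=].
  by rewrite in_itv/= andbT ltNge Av.
rewrite ge0_muleDr//; apply: leeD.
  apply: le_trans (measure_setC_cond_prob_ge _ _ _ _ mUle _ mlow (quantile t).1) _.
  by rewrite lee_wpmul2r// lee_fin /c le_max lexx orbT.
apply: le_trans (measure_cond_prob_le _ _ _ _ mUlt _ mhigh (quantile s).2) _.
by rewrite lee_wpmul2r// lee_fin /c le_max lexx.
Qed.

End panel.

Theorem proposition3p1 (R : realType) (T k : nat) (hT : (1 <= T)%N)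
    (hk : (1 <= k)%N) (B : set (Rvec R k)) (tau : R)
    (htau0 : 0 < tau) (htau1 : tau < 1)
    (Pobs : probability (obs_space R T k) R) (b : Rvec R k)
    (hb : identified_set B tau Pobs b) :
  (forall (v : R) (s t : 'I_T), s != t ->
    {ae distribution Pobs obsX, forall x,
      (cond_prob Pobs obsX
         [set w | residual b s w <= v < residual b t w]%R x
       <= (Num.max tau (1 - tau))%:E)%E}) /\
  (tau = 2^-1 ->
    forall (v : R) (s t : 'I_T), s != t ->
      {ae distribution Pobs obsX, forall x,
        (cond_prob Pobs obsX
           [set w | residual b s w <= v < residual b t w]%R x
         <= (2^-1)%:E)%E /\
        (cond_prob Pobs obsX
           [set w | residual b t w <= v < residual b s w]%R x
         <= (2^-1)%:E)%E}).
Proof.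
(* Stated for every ordered pair, so that exchanging [s] and [t] yields the opposite crossing when
   [tau] is one half. *)
have bound v s t : {ae distribution Pobs obsX, forall x,
      (cond_prob Pobs obsX
         [set w | residual b s w <= v < residual b t w]%R x
       <= (Num.max tau (1 - tau))%:E)%E}.
  apply: cond_prob_le; first exact: measurable_crossing.
  by move=> C mC; exact: crossing_measure_le hb mC.
split=> [v s t _|tauE v s t _]; first exact: bound.
have max_half : Num.max tau (1 - tau) = 2^-1.
  by rewrite tauE; apply/max_idPl; lra.
rewrite -max_half; apply: filterS2 (bound v s t) (bound v t s) => x; exact: conj.
Qed.
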